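(* Let $q$ be a prime power. The lattice of idempotent monomial clones on $\mathbb{F}_q$ is finite, i.e. there are only finitely many idempotent monomial clones on $\mathbb{F}_q$.
   Context: $\mathbb{N}=\{1,2,\dots\}$, $\mathbb{N}_0=\mathbb{N}\cup\{0\}$, $\mathbb{F}_q$ is the field with $q$ elements. A monomial is a formal product $g=\prod_{i\in\mathbb{N}}x_i^{\alpha(i)}$ with $\alpha(i)\in\mathbb{N}_0$, finitely many but at least one $\alpha(i)$ nonzero (so $1$ is not a monomial); $\mathrm{mI}(g)$ is the largest $i$ with $\alpha(i)\neq0$, called the arity of $g$. For $n\ge\mathrm{mI}(g)$ the $n$-ary induced function is $g^{\mathbb{F}_q^n}\colon\mathbb{F}_q^n\to\mathbb{F}_q$, $(x_1,\dots,x_n)\mapsto\prod_{i=1}^nx_i^{\alpha(i)}$. Monomials $m_1,m_2$ are equivalent if the $\mathrm{mI}(m_1)$-ary induced function of $m_1$ equals the $\mathrm{mI}(m_2)$-ary induced function of $m_2$ (i.e. for each $i$ the exponents of $x_i$ in $m_1$ and $m_2$ are equal, or both positive and congruent modulo $q-1$). A clone on a set $A$ is a set of finitary operations on $A$ (of arities $\ge1$) containing all projections and closed under composition. A set $M$ of monomials is a monomial clone on $\mathbb{F}_q$ if $\{m^{\mathbb{F}_q^n}\mid m\in M,\ n\ge\mathrm{mI}(m)\}$ is a clone on $\mathbb{F}_q$ and $M$ is closed under equivalent monomials. A monomial $g$ is idempotent (over $\mathbb{F}_q$) if its induced function satisfies $g^{\mathbb{F}_q^n}(x,\dots,x)=x$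 for all $x\in\mathbb{F}_q$, equivalently if the sum of its exponents is congruent to $1$ modulo $q-1$. A monomial clone is idempotent if all its monomials are idempotent. The idempotent monomial clones form a sublattice of the lattice of all monomial clones on $\mathbb{F}_q$ ordered by inclusion. *)

(* Defs.v *)
From mathcomp Require Import all_boot all_algebra finmap.
From mathcomp.multinomials Require Import monalg.
From mathcomp Require Import boolp classical_sets cardinality.

Set Implicit Arguments.
Unset Strict Implicit.
Unset Printing Implicit Defensive.

Import GRing.Theory.
Local Open Scope ring_scope.

(* Variables x_1, x_2, ... are numbered from 0: the exponent of x_(i+1) in m
   is m i. *)
Record monomial := Monomial {
  exponent :> {cmonom nat};
  exponent_neq1 : exponent != mone
}.

(* The .+1 undoes the numbering from 0: this is the largest index mI(m) of a
   variable occurring in m, counted from 1. *)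
Definition arity (m : monomial) : nat := (\max_(i <- finsupp m) i.+1)%N.

(* Only meaningful for arity m <= n: later variables are ignored. *)
Definition induced (F : finFieldType) (n : nat) (m : monomial)
    (x : n.-tuple F) : F :=
  \prod_(i < n) tnth x i ^+ m i.
Arguments induced : clear implicits.

Definition operations (A : Type) := forall n : nat, set (n.-tuple A -> A).

Record is_clone (A : Type) (C : operations A) : Prop := IsClone {
  clone_arity : forall n (f : n.-tuple A -> A), C n f -> (0 < n)%N;
  clone_proj : forall n (i : 'I_n), C n (fun x => tnth x i);
  clone_comp : forall k n (f : k.-tuple A -> A) (g : 'I_k -> n.-tuple A -> A),
    C k f -> (forall i, C n (g i)) -> C n (fun x => f [tuple g i x | i < k])
}.

(* Equality of operations bundled with their arity, hence arity m1 = arity m2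
   is part of the condition. *)
Definition equivalent_monomials (F : finFieldType) (m1 m2 : monomial) : Prop :=
  Tagged (fun n => n.-tuple F -> F) (induced F (arity m1) m1) =
  Tagged (fun n => n.-tuple F -> F) (induced F (arity m2) m2).

Definition induced_operations (F : finFieldType) (M : set monomial) :
    operations F :=
  fun n => [set f | exists m, [/\ M m, (arity m <= n)%N & f = induced F n m]]%classic.
Arguments induced_operations : clear implicits.

Definition monomial_clone (F : finFieldType) (M : set monomial) : Prop :=
  is_clone (induced_operations F M) /\
  (forall m1 m2, equivalent_monomials F m1 m2 -> M m1 -> M m2).

Definition idempotent_monomial (F : finFieldType) (m : monomial) : Prop :=
  forall n, (arity m <= n)%N -> forall x : F, induced F n m (nseq_tuple n x) = x.

Definition idempotent_monomial_clone (F : finFieldType)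
    (M : set monomial) : Prop :=
  monomial_clone F M /\ (forall m, M m -> idempotent_monomial F m).

(* Main.v *)
Require Import Defs.
From mathcomp Require Import all_boot all_algebra.
From mathcomp Require Import boolp classical_sets cardinality.
From mathcomp Require Import finmap finfield.
From mathcomp.multinomials Require Import monalg.

(** Put d = q - 1. The proof shows that an idempotent monomial clone M is
determined by its monomials in the first d * (d + 1) variables with all
exponents below q; there are finitely many of these, hence finitely many
clones.

A monomial m with few variables is, up to renaming its variables and reducing
its exponents modulo d, one of those finitely many monomials, and both changes
can be undone inside a clone. A monomial m in M with more than d * (d + 1)
variables has, by the pigeonhole principle, d + 2 variables whose exponents
agree modulo d. Let t consist of d of them and let y be a further one. Then m
is a substitution instance of two members of M with fewer variables:
- m', which is m without the variables of t. It arises from m by identifying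
  every variable of t with y: this adds to the exponent of y the d exponents of
  t, which are congruent to each other, hence a multiple of d;
- g, the product of y with the powers of the variables of t occurring in m. It
  arises from m by identifying all variables outside t with y: idempotence says
  that the exponents of m sum to 1 modulo d, and those of t contribute 0, so
  that y gets an exponent congruent to 1.
Replacing y by m' in g gives back m. By induction on the number of variables, a
clone that contains the small monomials of M contains all of M: this is
[mem_of_trace]. The passage from clones of operations to substitutions of
exponents is [mem_subst]. *)

Import GRing.Theory.

(** * Exponents that induce the same power function *)

(** Working with the power functions themselves, rather than with congruences
modulo q - 1, means that no generator of the multiplicative group is needed to
exploit idempotence. *)
Definition same_power (F : finFieldType) (a b : nat) : Prop :=
  forall x : F, (x ^+ a = x ^+ b)%R.

(** Only a positive exponent sends 0 to 0. *)
Lemma same_power_eq0 {F : finFieldType} {a b : nat} :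
  same_power F a b -> (a == 0) = (b == 0).
Proof.
move=> /(_ 0%R); rewrite !expr0n.
by case: (a == 0); case: (b == 0) => //= /eqP; rewrite ?[(0 == 1)%R]eq_sym oner_eq0.
Qed.

Lemma same_power_sym {F : finFieldType} {a b : nat} :
  same_power F a b -> same_power F b a.
Proof. by move=> ab x. Qed.

Lemma expf_card_pred {F : finFieldType} (x : F) :
  (x != 0 -> x ^+ #|F|.-1 = 1)%R.
Proof.
move=> x0; apply: (mulfI x0); rewrite mulr1 -exprS prednK ?expf_card //.
exact: ltnW (finNzRing_gt1 F).
Qed.

Lemma expf_mod {F : finFieldType} (x : F) (a : nat) :
  (x != 0 -> x ^+ (a %% #|F|.-1) = x ^+ a)%R.
Proof.
move=> x0; rewrite [in RHS](divn_eq a #|F|.-1) exprD mulnC exprM.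
by rewrite expf_card_pred // expr1n mul1r.
Qed.

Lemma same_power_mod (F : finFieldType) (a b : nat) :
  0 < a -> 0 < b -> a = b %[mod #|F|.-1] -> same_power F a b.
Proof.
move=> a0 b0 ab x; have [->|x0] := eqVneq x 0%R.
  by rewrite !expr0n !gtn_eqF.
by rewrite -(expf_mod x a x0) ab expf_mod.
Qed.

(** * Monomials with prescribed exponents *)

Lemma monomial_finsupp (m : monomial) (i : nat) : (i \in finsupp m) = (m i != 0).
Proof. by rewrite mem_finsupp. Qed.

Lemma finsupp_arity (m : monomial) (i : nat) : i \in finsupp m -> i < arity m.
Proof. by move=> im; apply: (@leq_bigmax_seq _ _ xpredT (fun i => i.+1)). Qed.

Lemma exponent_ge_arity (m : monomial) (i : nat) : arity m <= i -> m i = 0.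
Proof.
move=> le; apply/eqP; apply: contraLR le.
by rewrite -ltnNge -monomial_finsupp; exact: finsupp_arity.
Qed.

Lemma exists_monomial (K : {fset nat}) (f : nat -> nat) :
  (exists2 i, i \in K & f i != 0) ->
  exists m : monomial, forall i, m i = if i \in K then f i else 0.
Proof.
case=> i0 iK fi0; pose e : {cmonom nat} := [cmonom f i | i in K]%M.
have eE i : e i = if i \in K then f i else 0 by rewrite cmE fsfun_fun.
have e1 : e != mone.
  by apply: contraNneq fi0 => /(congr1 (fun c : {cmonom nat} => c i0)); rewrite eE iK cm1 => ->.
by exists (Monomial e1).
Qed.

Lemma exists_variable (i : nat) :
  exists m : monomial, forall j, m j = (j == i).
Proof.
have [|m mE] := @exists_monomial [fset i]%fset (fun=> 1).
  by exists i; rewrite ?inE.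
by exists m => j; rewrite mE inE; case: eqP.
Qed.

(** Operations see a monomial through its first variables, while the counting
arguments range over the variables that occur; this translates between the
two. *)
Lemma sum_finsupp (m : monomial) (n : nat) (h : nat -> nat) :
  arity m <= n ->
  \sum_(j < n) m j * h j = \sum_(j <- finsupp m) m j * h j.
Proof.
move=> le; rewrite -(big_mkord predT (fun j => m j * h j)).
rewrite (bigID (fun j => j \in finsupp m)) /= [X in _ + X]big1_seq ?addn0; last first.
  by move=> j /andP[]; rewrite monomial_finsupp negbK => /eqP->.
rewrite -big_filter; apply: perm_big; apply: uniq_perm.
- by rewrite filter_uniq ?iota_uniq.
- exact: fset_uniq.
move=> j; rewrite mem_filter mem_index_iota /=.
by apply: andb_idr => /finsupp_arity /leq_trans ->.
Qed.

(** * Closure of monomial clones under substitution *)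

(** Evaluating at points with a single coordinate different from 1 isolates one
exponent, so that an induced operation determines the power functions of all
exponents. *)
Lemma induced_point (F : finFieldType) (n : nat) (m : monomial) (i : 'I_n) (y : F) :
  induced F n m [tuple if j == i then y else 1%R | j < n] = (y ^+ m i)%R.
Proof.
rewrite /induced (bigD1 i) //= big1 ?mulr1 ?tnth_mktuple ?eqxx // => j ji.
by rewrite tnth_mktuple (negPf ji) expr1n.
Qed.

(** Equivalence of monomials involves their arities; these agree because
exponents with the same power function vanish together. *)
Lemma mem_same_power {F : finFieldType} {M : set monomial} (m c : monomial) :
  monomial_clone F M -> M m -> (forall i, same_power F (m i) (c i)) -> M c.
Proof.
move=> [_ Meq] Mm mc; apply: Meq Mm.
have supp : finsupp m = finsupp c.
  by apply/fsetP => i; rewrite !monomial_finsupp (same_power_eq0 (mc i)).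
have ar : arity m = arity c by rewrite /arity supp.
rewrite /equivalent_monomials ar.
suff -> : induced F (arity c) m = induced F (arity c) c by [].
by apply/funext => x; apply: eq_bigr => i _; exact: mc.
Qed.

(** The composite of the induced operations is induced by some member of the
clone, whose exponents are then compared with those of c at the points of
[induced_point]. *)
Lemma mem_subst {F : finFieldType} {M : set monomial}
    (m : monomial) (g : nat -> monomial) (c : monomial) :
  monomial_clone F M -> M m -> (forall j, M (g j)) ->
  (forall i, same_power F (c i) (\sum_(j <- finsupp m) m j * g j i)) -> M c.
Proof.
move=> MM Mm Mg cE; have [[_ _ comp] _] := MM.
pose k := arity m; pose n := \max_(j < k) arity (g j).
have gn (j : 'I_k) : arity (g j) <= n by exact: (leq_bigmax j).
have Cm : induced_operations F M k (induced F k m) by exists m.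
have Cg (j : 'I_k) : induced_operations F M n (induced F n (g j)).
  by exists (g j).
have [m' [Mm' m'n /(congr1 (@^~ _)) eqm']] := comp _ _ _ _ Cm Cg.
apply: (mem_same_power m' c MM Mm') => i y.
rewrite cE -(sum_finsupp m k) //.
have [ltin|lein] := ltnP i n; last first.
  rewrite (exponent_ge_arity m') ?(leq_trans m'n) // big1 // => j _.
  by rewrite (exponent_ge_arity (g j)) ?muln0 // (leq_trans (gn j)).
have := eqm' [tuple if j == Ordinal ltin then y else 1%R | j < n].
rewrite induced_point /= => <-.
rewrite expr_sum; apply: eq_bigr => j _.
by rewrite tnth_mktuple induced_point /= -exprM mulnC.
Qed.

Lemma mem_variable {F : finFieldType} {M : set monomial} (i : nat) (c : monomial) :
  monomial_clone F M -> (forall j, c j = (j == i)) -> M c.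
Proof.
move=> MM cE; have [[_ proj _] _] := MM.
have [m [Mm mi /(congr1 (@^~ _)) eqm]] := proj _ (@ord_max i).
apply: (mem_same_power m c MM Mm) => j y; rewrite cE.
have [ltj|lej] := ltnP j i.+1; last first.
  by rewrite exponent_ge_arity ?(leq_trans mi) // gtn_eqF.
have := eqm [tuple if l == Ordinal ltj then y else 1%R | l < i.+1].
rewrite induced_point /= tnth_mktuple => <-.
by rewrite eq_sym -val_eqE /=; case: (j == i); rewrite ?expr1 ?expr0.
Qed.

(** The map s may identify variables: their exponents add up. *)
Lemma mem_rename {F : finFieldType} {M : set monomial}
    (m : monomial) (s : nat -> nat) (c : monomial) :
  monomial_clone F M -> M m ->
  (forall i, same_power F (c i) (\sum_(j <- finsupp m | s j == i) m j)) -> M c.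
Proof.
move=> MM Mm cE.
have [X XE] := boolp.choice exists_variable.
apply: (mem_subst m (fun j => X (s j)) c MM Mm) => [j|i].
  exact: mem_variable MM (XE (s j)).
move=> y; rewrite cE; congr (_ ^+ _)%R; rewrite big_mkcond.
by apply: eq_bigr => j _; rewrite XE eq_sym; case: eqP; rewrite ?muln1 ?muln0.
Qed.

Lemma mem_rename_inj {F : finFieldType} {M : set monomial}
    (m : monomial) (s : nat -> nat) (c : monomial) :
  monomial_clone F M -> M m ->
  {in finsupp m &, injective s} ->
  {in finsupp m, forall j, same_power F (c (s j)) (m j)} ->
  (forall i, c i != 0 -> exists2 j, j \in finsupp m & i = s j) -> M c.
Proof.
move=> MM Mm inj cs supp; apply: (mem_rename m s c MM Mm) => i.
have [ci|] := eqVneq (c i) 0; last first.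
  case/supp=> j jm ->; rewrite big_mkcond (bigD1_seq j) ?fset_uniq //= eqxx.
  rewrite big1_seq ?addn0; first exact: cs.
  by move=> l /andP[lj lm]; case: eqP => // /inj => /(_ lm jm)/eqP; rewrite (negPf lj).
move=> y; rewrite ci big1_seq // => j /andP[/eqP sj jm].
have := same_power_eq0 (cs _ jm); rewrite sj ci eqxx => /esym/eqP; exact.
Qed.

(** * Monomials with few variables *)

(** A finite fingerprint of M: its monomials in the first N variables with
exponents below q, each recorded by its exponent vector. *)
Definition trace (F : finFieldType) (N : nat) (M : set monomial) :
    {set {ffun 'I_N -> 'I_#|F|}} :=
  [set v : {ffun 'I_N -> 'I_#|F|} | `[< exists2 m : monomial, M m &
     (forall i : 'I_N, m i = v i) /\ (forall i, N <= i -> m i = 0) >]]%SET.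

(** A positive multiple of q - 1 reduces to q - 1 and not to 0: x ^ (q - 1) and
x ^ 0 differ at 0. *)
Definition reduced_exponent (F : finFieldType) (a : nat) : nat :=
  if a == 0 then 0 else (a.-1 %% #|F|.-1).+1.

Lemma card_pred_gt0 (F : finFieldType) : 0 < #|F|.-1.
Proof. by rewrite -subn1 subn_gt0 finNzRing_gt1. Qed.

Lemma reduced_exponent_lt (F : finFieldType) (a : nat) :
  reduced_exponent F a < #|F|.
Proof.
have F1 := finNzRing_gt1 F.
rewrite /reduced_exponent; case: eqP => _; first exact: ltnW.
by rewrite -[X in _ < X]prednK ?ltnS ?ltn_pmod ?card_pred_gt0 // ltnW.
Qed.

Lemma same_power_reduced (F : finFieldType) (a : nat) :
  same_power F (reduced_exponent F a) a.
Proof.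
rewrite /reduced_exponent; have [->|a0] := eqVneq a 0; first by [].
apply: same_power_mod; rewrite ?lt0n //.
by rewrite -addn1 modnDml addn1 prednK ?lt0n.
Qed.

Lemma finsupp_neq0 (m : monomial) : 0 < #|` finsupp m|.
Proof.
rewrite cardfs_gt0; apply/fset0Pn; apply: contrapT => none.
have := exponent_neq1 m; apply/negP; rewrite negbK; apply/cmP => i.
rewrite cm1; apply/eqP; apply: contraT; rewrite -monomial_finsupp => im.
by case: none; exists i.
Qed.

(** The variables of m are moved to the first places and its exponents are
reduced; the resulting monomial c is seen by the traces, and m is recovered
from c in M2. *)
Lemma mem_trace {F : finFieldType} {M1 M2 : set monomial} (N : nat) (m : monomial) :
  monomial_clone F M1 -> monomial_clone F M2 ->
  trace F N M1 \subset trace F N M2 ->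
  M1 m -> #|` finsupp m| <= N -> M2 m.
Proof.
move=> MM1 MM2 tr M1m sN; pose s : seq nat := finsupp m.
have us : uniq s by exact: fset_uniq.
pose f i := if i < size s then reduced_exponent F (m (nth 0 s i)) else 0.
have sF i : i < size s -> same_power F (f i) (m (nth 0 s i)).
  by rewrite /f => ->; exact: same_power_reduced.
have f0 i : (f i != 0) = (i < size s).
  have [lt|ge] := ltnP i (size s); last by rewrite /f ltnNge ge eqxx.
  by rewrite (same_power_eq0 (sF _ lt)) -monomial_finsupp mem_nth.
have [c cE] : exists c : monomial, forall i, c i = f i.
  have [|c cE] := @exists_monomial [fset i in iota 0 (size s)]%fset f.
    by exists 0; rewrite ?inE ?f0 ?mem_iota /= ?finsupp_neq0.
  exists c => i; rewrite cE inE /= mem_iota /=; case: ltnP => // ge.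
  by apply/esym/eqP; rewrite -[_ == _]negbK f0 -leqNgt.
have cs i : (i \in finsupp c) = (i < size s) by rewrite monomial_finsupp cE f0.
have M1c : M1 c.
  apply: (mem_rename_inj m (fun j => index j s) c MM1 M1m).
  - by move=> i j im jm /(congr1 (nth 0 s)); rewrite !nth_index.
  - move=> j jm; rewrite cE -[X in same_power F _ (m X)](nth_index 0 jm).
    by apply: sF; rewrite index_mem.
  - move=> i; rewrite cE f0 => lt; exists (nth 0 s i); first exact: mem_nth.
    by rewrite index_uniq.
suff M2c : M2 c.
  apply: (mem_rename_inj c (nth 0 s) m MM2 M2c).
  - by move=> i j; rewrite !cs => si sj /eqP; rewrite nth_uniq // => /eqP.
  - by move=> j; rewrite cs cE => lt; apply: same_power_sym; exact: sF.
  - move=> i; rewrite -monomial_finsupp => im; exists (index i s).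
      by rewrite cs index_mem.
    by rewrite nth_index.
have fF i : f i < #|F|.
  rewrite /f; case: ifP => _; first exact: reduced_exponent_lt.
  exact: ltnW (finNzRing_gt1 F).
pose v := [ffun i : 'I_N => Ordinal (fF i)].
have : v \in trace F N M1.
  rewrite inE; apply/asboolP; exists c => //; split=> [i|i Ni].
    by rewrite ffunE cE.
  by apply/eqP; rewrite -[_ == _]negbK cE f0 -leqNgt (leq_trans sN).
move=> /(fintype.subsetP tr); rewrite inE => /asboolP[c' M2c' [c'v c'0]].
apply: (mem_same_power c' c MM2 M2c') => i x; congr (_ ^+ _)%R.
have [lt|ge] := ltnP i N; first by rewrite (c'v (Ordinal lt)) ffunE cE.
by rewrite c'0 //; apply/esym/eqP; rewrite -[_ == _]negbK cE f0 -leqNgt (leq_trans sN).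
Qed.

(** * Monomials with many variables *)

Lemma idempotent_sum (F : finFieldType) (m : monomial) :
  idempotent_monomial F m -> same_power F (\sum_(j <- finsupp m) m j) 1.
Proof.
move=> idm x; rewrite expr1 -[RHS](idm (arity m)) //.
have <- : \sum_(j < arity m) m j = \sum_(j <- finsupp m) m j.
  have m1 j : m j = m j * 1 by rewrite muln1.
  rewrite (eq_bigr _ (fun j _ => m1 _)) [RHS](eq_bigr _ (fun j _ => m1 _)).
  exact: (sum_finsupp m _ (fun=> 1)).
by rewrite expr_sum; apply: eq_bigr => i _; rewrite tnth_nseq.
Qed.

Lemma pigeonhole_mod (s : seq nat) (f : nat -> nat) (d k : nat) :
  0 < d -> d * k < size s ->
  exists r, k < count (fun j => f j %% d == r) s.
Proof.
move=> d0 big; apply/not_existsP => small; move: big.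
apply/negP; rewrite -leqNgt -sum1_size.
rewrite (partition_big (fun j => Ordinal (ltn_pmod (f j) d0)) xpredT) //=.
rewrite -[X in X * k]card_ord -sum_nat_const; apply: leq_sum => r _.
rewrite sum1_count leqNgt; apply/negP => kr; apply: (small (val r)).
by apply: leq_trans kr _; apply: sub_count => j /= /eqP/(congr1 val) /= ->.
Qed.

(** The bound d * (d + 1) forces d + 2 variables into one residue class: d for
t, one for y, and a last one so that g has fewer variables than m. *)
Lemma mem_of_trace {F : finFieldType} {M1 M2 : set monomial} :
  idempotent_monomial_clone F M1 -> monomial_clone F M2 ->
  trace F (#|F|.-1 * #|F|.-1.+1) M1 \subset trace F (#|F|.-1 * #|F|.-1.+1) M2 ->
  (M1 `<=` M2)%classic.
Proof.
move=> [MM1 idM1] MM2 tr m.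
have [n] := ubnP #|` finsupp m|; elim: n m => // n IH m; rewrite ltnS => sn M1m.
set d := #|F|.-1 in tr *; have d0 : 0 < d by exact: card_pred_gt0.
have [small|big] := leqP #|` finsupp m| (d * d.+1).
  exact: mem_trace MM1 MM2 tr M1m small.
pose s : seq nat := finsupp m.
have us : uniq s by exact: fset_uniq.
have [r rT] := @pigeonhole_mod s m d d.+1 d0 big.
pose T := [seq j <- s | m j %% d == r].
have sT : d.+1 < size T by rewrite size_filter.
have uT : uniq T by rewrite filter_uniq.
pose t := take d T; pose j0 := nth 0 T d.
have st : size t = d by rewrite size_takel // ltnW // ltnW.
have ut : uniq t by rewrite take_uniq.
have j0T : j0 \in T by rewrite mem_nth // ltnW.
have j0t : j0 \notin t by rewrite in_take // index_uniq ?ltnn // ltnW.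
have tT j : j \in t -> j \in T by exact: mem_take.
have Ts j : j \in T -> j \in s by rewrite mem_filter => /andP[].
have Tr j : j \in T -> m j %% d = r by rewrite mem_filter => /andP[/eqP].
have sm0 j : (j \in s) = (m j != 0) by exact: monomial_finsupp.
have j0m : m j0 != 0 by rewrite -sm0 Ts.
have sum1 i : \sum_(j <- s | j == i) m j = m i.
  have [im|] := boolP (i \in s).
    by rewrite big_mkcond (bigD1_seq i) //= eqxx big1 ?addn0 // => j /negPf ->.
  rewrite sm0 negbK => /eqP mi; rewrite mi big1 // => j /eqP ->; exact: mi.
(* d congruent exponents sum to a multiple of d. *)
have sumt : d %| \sum_(j <- s | j \in t) m j.
  have -> : \sum_(j <- s | j \in t) m j = \sum_(j <- t) m j.
    rewrite -big_filter; apply: perm_big; apply: uniq_perm => //.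
      by rewrite filter_uniq.
    by move=> j; rewrite mem_filter andb_idr // => /tT/Ts.
  rewrite /dvdn -modn_summ (eq_big_seq (fun=> r)); last by move=> j /tT/Tr.
  by rewrite big_const_seq count_predT iter_addn_0 st modnMl.
have [g gE] : exists g : monomial, forall i,
    g i = if i \in j0 :: t then if i == j0 then 1 else m i else 0.
  have [|g gE] := @exists_monomial [fset i in j0 :: t]%fset
    (fun i => if i == j0 then 1 else m i).
    by exists j0; rewrite ?eqxx // !inE eqxx.
  by exists g => i; rewrite gE !inE.
have [m' m'E] : exists m' : monomial, forall i, m' i = if i \in t then 0 else m i.
  have [|m' m'E] := @exists_monomial (finsupp m)
    (fun i => if i \in t then 0 else m i).
    by exists j0; [exact: Ts | rewrite (negPf j0t)].
  exists m' => i; rewrite m'E monomial_finsupp; case: eqP => [->|//].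
  by case: ifP.
have gs i : (i \in finsupp g) = (i \in j0 :: t).
  rewrite monomial_finsupp gE inE; have [//|_] := eqVneq i j0 => /=.
  by case: ifP => // /tT/Ts im; rewrite -(sm0 i) im.
have M1g : M1 g.
  apply: (mem_rename m (fun j => if j \in t then j else j0) g MM1 M1m) => i.
  rewrite gE inE; have [->|ij0] := eqVneq i j0 => /=.
    set S := (X in same_power F _ X); have SE : S = \sum_(j <- s | j \notin t) m j.
      apply: eq_bigl => j; case: ifP => jt; rewrite ?eqxx //.
      by apply: contraTF jt => /eqP ->.
    move=> x; rewrite expr1; have [->|x0] := eqVneq x 0%R.
      rewrite expr0n SE big_mkcond (bigD1_seq j0) ?Ts //= j0t.
      by rewrite addn_eq0 (negPf j0m).
    have := idempotent_sum _ _ (idM1 _ M1m) x.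
    rewrite (bigID (mem t)) /= exprD expr1 => {1}<-.
    by rewrite -(expf_mod _ _ x0) (eqP sumt) expr0 mul1r SE.
  case: ifP => it.
    rewrite (eq_bigl (pred1 i)) ?sum1 // => j /=.
    case: ifP => // jt; rewrite eq_sym (negPf ij0).
    by apply/esym; apply: contraFF jt => /eqP ->.
  rewrite big1 // => j; case: ifP => jt /eqP ji.
    by rewrite -ji jt in it.
  by rewrite ji eqxx in ij0.
have M1m' : M1 m'.
  apply: (mem_rename m (fun j => if j \in t then j0 else j) m' MM1 M1m) => i.
  rewrite m'E; case: ifP => it.
    rewrite big1 // => j; case: ifP => jt /eqP ji.
      by rewrite -ji (negPf j0t) in it.
    by rewrite ji it in jt.
  have [->|ij0] := eqVneq i j0.
    rewrite (bigID (mem t)) /= (eq_bigl (mem t)); last first.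
      by move=> j /=; case: ifP; rewrite ?eqxx ?andbF.
    rewrite [X in _ + X](eq_bigl (pred1 j0)) ?sum1; last first.
      move=> j /=; case: ifP => jt; rewrite ?andbT ?andbF //.
      by apply/esym; apply: contraTF jt => /eqP ->.
    apply: same_power_mod; rewrite ?addn_gt0 ?lt0n ?j0m ?orbT //.
    by rewrite -modnDml (eqP sumt).
  rewrite (eq_bigl (pred1 i)) ?sum1 // => j /=.
  case: ifP => // jt; rewrite eq_sym (negPf ij0).
  by apply/esym; apply: contraTF jt => /eqP ->; rewrite it.
have M2g : M2 g.
  apply: IH M1g; apply: leq_trans sn.
  have -> : finsupp g = [fset i in j0 :: t]%fset by apply/fsetP => i; rewrite gs !inE.
  rewrite card_fseq (leq_ltn_trans (size_undup _)) //= st.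
  by rewrite (leq_trans sT) // size_filter count_size.
have M2m' : M2 m'.
  apply: IH M1m'; apply: leq_trans sn.
  apply: fproper_ltn_card; rewrite fproperE; apply/andP; split.
    apply/fsubsetP => i; rewrite !monomial_finsupp m'E.
    by case: ifP.
  pose i := nth 0 t 0; have it : i \in t by rewrite mem_nth // st.
  apply/fsubsetPn; exists i; first exact/Ts/tT.
  by rewrite monomial_finsupp m'E it.
(* Substituting m' for x_j0 in g restores m. *)
have [X XE] := boolp.choice exists_variable.
apply: (mem_subst g (fun j => if j == j0 then m' else X j) m MM2 M2g) => [j|i].
  by case: ifP => // _; exact: mem_variable MM2 (XE j).
move=> x; congr (_ ^+ _)%R.
rewrite (@perm_big _ _ _ _ _ (j0 :: t)) /=; last first.
  by apply: uniq_perm; rewrite ?fset_uniq //= ?j0t.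
rewrite big_cons gE inE eqxx mul1n m'E.
rewrite (eq_big_seq (fun j => if j == i then m i else 0)); last first.
  move=> j jt; have jj0 : j != j0 by apply: contraNneq j0t => <-.
  rewrite gE inE jt orbT (negPf jj0) XE eq_sym.
  by case: eqP => [->|]; rewrite ?muln1 ?muln0.
case: ifP => it.
  by rewrite (bigD1_seq i) //= eqxx big1 ?addn0 // => j /negPf ->.
by rewrite big1_seq ?addn0 // => j /andP[_ jt]; case: eqP => // ji; rewrite -ji jt in it.
Qed.

Theorem proposition7p3 (q : nat)
    (q_prime_power : exists p k : nat, [/\ prime p, 0 < k & q = p ^ k])
    (F : finFieldType) (cardF : #|F| = q) :
  finite_set [set M : set monomial | idempotent_monomial_clone F M]%classic.
Proof.
(* A clone can be recovered from its trace, so the clones lie in the image of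
   the finite type of all traces. *)
set N := #|F|.-1 * #|F|.-1.+1; pose C := idempotent_monomial_clone F.
pose clone_of (S : {set {ffun 'I_N -> 'I_#|F|}}) : set monomial :=
  xget set0 [set M | C M /\ trace F N M = S]%classic.
apply: (@sub_finite_set _ _ (clone_of @` setT)%classic); last first.
  exact/finite_image/finite_finset.
move=> M CM; exists (trace F N M) => //.
rewrite /clone_of; case: xgetP => [M' _ [CM' trM']|/(_ M)/not_andP[]//].
have sub (A B : set monomial) : C A -> C B ->
    trace F N A = trace F N B -> (A `<=` B)%classic.
  by move=> CA [CB _] AB; apply: (mem_of_trace CA CB); rewrite AB.
by apply/seteqP; split; apply: sub.
Qed.
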